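(* Let $n,p,k$ be positive integers with $k\le\min(n,p)$, let $\lambda>0$, $\boldsymbol X\in\mathbb R^{n\times p}$, $\boldsymbol y\in\mathbb R^n$, and let $$v^*=\min_{\boldsymbol\beta\in\mathbb R^p}\left\{\tfrac1n\|\boldsymbol y-\boldsymbol X\boldsymbol\beta\|_2^2+\lambda\|\boldsymbol\beta\|_2^2:\ \tfrac1p\sum_{i\in[p]}\mathbb I(|\beta_i|\le 0)\ge 1-\tfrac kp\right\}$$ (the chance-constrained form of sparse ridge regression; its constraint is equivalent to $\|\boldsymbol\beta\|_0\le k$). For the bisection heuristic described in the context, with stopping tolerance $\hat\delta>0$ and output $v^{\mathrm{heur}}$, the following two properties hold: (i) it terminates with at most $\left\lfloor\log_2\left(\frac{\|\boldsymbol y\|_2^2}{n\hat\delta}\right)\right\rfloor+1$ iterations; and (ii) it generates a feasible solution to the problem defining $v^*$, i.e., $v^*\le v^{\mathrm{heur}}$.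
   Context: $[p]=\{1,\dots,p\}$; $\mathbb I(\cdot)$ is the indicator function; $\|\boldsymbol\beta\|_0$ is the number of nonzero entries of $\boldsymbol\beta$. Bisection heuristic: let $L=0$ and $U=\|\boldsymbol y\|_2^2/n$ be known lower and upper bounds for the problem defining $v^*$, and let $\hat\delta>0$ be the stopping tolerance parameter. While $U-L>\hat\delta$: set $q\leftarrow(L+U)/2$; let $\hat{\boldsymbol\beta}$ be an optimal solution of $$\min_{\boldsymbol\beta\in\mathbb R^p}\left\{\sum_{i\in[p]}|\beta_i|:\ \tfrac1n\|\boldsymbol y-\boldsymbol X\boldsymbol\beta\|_2^2+\lambda\|\boldsymbol\beta\|_2^2\le v^U\right\}\quad\text{with } v^U=q,$$ and set $\hat z_i=\mathbb I(\hat\beta_i=0)$ for all $i\in[p]$; if $\sum_{i\in[p]}\hat z_i\ge p-k$ then set $U\leftarrow q$, otherwise set $L\leftarrow q$. When the loop ends, output $v^{\mathrm{heur}}\leftarrow U$.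
   Formalization: The bound in (i) is negative or undefined when ‖y‖²/(nδ) < 1/2; there the formal theorem states 0 iterations, and the literal bound otherwise. If the subproblem at level q is infeasible, so that no optimal solution exists, the iteration sets L ← q. *)

(* Defs.v *)
From HB Require Import structures.
From mathcomp Require Import all_boot all_order all_algebra.
From mathcomp Require Import all_classical all_reals all_analysis.
Set Implicit Arguments.
Unset Strict Implicit.
Unset Printing Implicit Defensive.
Import Order.TTheory GRing.Theory Num.Theory.
Local Open Scope classical_set_scope.
Local Open Scope ring_scope.

(* The library norm `|v| on matrices is the sup norm, hence this definition. *)
Definition sqnorm2 (R : realType) (m : nat) (v : 'cV[R]_m) : R :=
  \sum_(i < m) v i ord0 ^+ 2.

Definition norm1 (R : realType) (m : nat) (v : 'cV[R]_m) : R :=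
  \sum_(i < m) `|v i ord0|.

Definition ridge_obj (R : realType) (n p : nat) (X : 'M[R]_(n, p))
    (y : 'cV[R]_n) (lambda : R) (beta : 'cV[R]_p) : R :=
  n%:R^-1 * sqnorm2 (y - X *m beta) + lambda * sqnorm2 beta.

Definition chance_feasible (R : realType) (p k : nat) : set 'cV[R]_p :=
  [set beta : 'cV[R]_p | 1 - k%:R / p%:R
     <= p%:R^-1 * \sum_(i < p) (`|beta i ord0| <= 0)%R%:R :> R].

Definition is_argmin (R : realType) (T : Type) (F : set T) (f : T -> R)
    (x : T) : Prop :=
  F x /\ forall x', F x' -> f x <= f x'.

Definition is_min_value (R : realType) (T : Type) (F : set T) (f : T -> R)
    (v : R) : Prop :=
  exists2 x, is_argmin F f x & f x = v.

(* Feasible set of the l1-minimization subproblem at level [vU]. *)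
Definition sublevel (R : realType) (n p : nat) (X : 'M[R]_(n, p))
    (y : 'cV[R]_n) (lambda vU : R) : set 'cV[R]_p :=
  [set beta : 'cV[R]_p | ridge_obj X y lambda beta <= vU].

Definition zhat (R : realType) (p : nat) (beta : 'cV[R]_p) (i : 'I_p) : nat :=
  (beta i ord0 == 0)%R.

(* [inc] is the solution found at the last update of the upper bound. It has no
   influence on the bounds; it records the solution that the method produces. *)
Record bisection_state (R : realType) (p : nat) : Type := State {
  lo : R;
  up : R;
  inc : 'cV[R]_p
}.

(* The initial upper bound is the objective value at 0. *)
Definition bisection_init (R : realType) (n p : nat) (y : 'cV[R]_n) :
    bisection_state R p :=
  State 0 (sqnorm2 y / n%:R) 0.

Definition loop_guard (R : realType) (p : nat) (delta : R)
    (s : bisection_state R p) : Prop :=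
  delta < up s - lo s.

Definition midpoint (R : realType) (p : nat) (s : bisection_state R p) : R :=
  (lo s + up s) / 2.

(* One iteration of the loop, as a relation since any optimal solution of the
   subproblem may be used. For small q the subproblem can be infeasible; no
   candidate is then available and the lower bound is raised. *)
Variant bisection_step (R : realType) (n p : nat) (X : 'M[R]_(n, p))
    (y : 'cV[R]_n) (lambda : R) (k : nat) (delta : R)
    (s : bisection_state R p) : bisection_state R p -> Prop :=
  | StepUp (beta : 'cV[R]_p) :
      loop_guard delta s ->
      is_argmin (sublevel X y lambda (midpoint s)) (@norm1 R p) beta ->
      (p - k <= \sum_(i < p) zhat beta i)%N ->
      bisection_step X y lambda k delta s (State (lo s) (midpoint s) beta)
  | StepLo (beta : 'cV[R]_p) :
      loop_guard delta s ->
      is_argmin (sublevel X y lambda (midpoint s)) (@norm1 R p) beta ->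
      (\sum_(i < p) zhat beta i < p - k)%N ->
      bisection_step X y lambda k delta s (State (midpoint s) (up s) (inc s))
  | StepInfeasible :
      loop_guard delta s ->
      sublevel X y lambda (midpoint s) = set0 ->
      bisection_step X y lambda k delta s (State (midpoint s) (up s) (inc s)).

(* [bisection_run X y lambda k delta m s]: some execution is in state [s] after
   exactly [m] iterations. *)
Inductive bisection_run (R : realType) (n p : nat) (X : 'M[R]_(n, p))
    (y : 'cV[R]_n) (lambda : R) (k : nat) (delta : R) :
    nat -> bisection_state R p -> Prop :=
  | RunInit : bisection_run X y lambda k delta 0 (bisection_init p y)
  | RunStep (m : nat) (s t : bisection_state R p) :
      bisection_run X y lambda k delta m s ->
      bisection_step X y lambda k delta s t ->
      bisection_run X y lambda k delta m.+1 t.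

Definition log2 (R : realType) (x : R) : R := ln x / ln 2.

(* Main.v *)
(** Every iteration halves the interval, so its width after [m] iterations is
  ||y||^2 / (n 2^m). Iteration [m.+1] is entered only if that width exceeds
  [delta], whence 2^m < ||y||^2 / (n delta), which bounds [m]. A subproblem that
  is feasible has an optimal solution because the ridge penalty makes its
  feasible set compact. The upper bound always dominates the objective value of
  the recorded solution, which satisfies the chance constraint. *)
Require Import Defs.
From mathcomp Require Import all_boot all_order all_algebra.
From mathcomp Require Import all_classical all_reals all_analysis.
From mathcomp Require Import lra.
Set Implicit Arguments.
Unset Strict Implicit.
Import Order.TTheory GRing.Theory Num.Theory.
Import numFieldNormedType.Exports.
Local Open Scope ring_scope.

Lemma sqnorm2_ge0 (R : realType) (m : nat) (v : 'cV[R]_m) : 0 <= sqnorm2 v.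
Proof. by apply: sumr_ge0 => i _; exact: sqr_ge0. Qed.

Lemma sqr_coord_le_sqnorm2 (R : realType) (m : nat) (v : 'cV[R]_m) (i : 'I_m) :
  v i ord0 ^+ 2 <= sqnorm2 v.
Proof.
rewrite /sqnorm2 (bigD1 i) //= lerDl.
by apply: sumr_ge0 => j _; exact: sqr_ge0.
Qed.

Lemma continuous_sumr (R : realType) (T : topologicalType) (m : nat)
    (f : 'I_m -> T -> R) :
  (forall i, continuous (f i)) -> continuous (fun x => \sum_(i < m) f i x).
Proof.
by move=> fc; apply: continuous_big => //; exact: add_continuous.
Qed.

Lemma continuous_coord_trmx (R : realType) (p : nat) (i : 'I_p) :
  continuous (fun v : 'rV[R]_p => v^T i ord0).
Proof.
by move=> v; under eq_fun do rewrite mxE; exact: coord_continuous.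
Qed.

Lemma continuous_norm1_trmx (R : realType) (p : nat) :
  continuous (fun v : 'rV[R]_p => norm1 v^T).
Proof.
apply: continuous_sumr => i v.
apply: (@continuous_comp _ _ _ (fun v => v^T i ord0)).
  exact: continuous_coord_trmx.
exact: norm_continuous.
Qed.

Lemma continuous_sqnorm2 (R : realType) (T : topologicalType) (m : nat)
    (f : T -> 'cV[R]_m) :
  (forall i, continuous (fun x => f x i ord0)) ->
  continuous (fun x => sqnorm2 (f x)).
Proof.
move=> fc; apply: continuous_sumr => i x.
exact: (continuous_comp (fc i x) (@exprn_continuous R 2 _)).
Qed.

Lemma continuous_ridge_obj_trmx (R : realType) (n p : nat) (X : 'M[R]_(n, p))
    (y : 'cV[R]_n) (lambda : R) :
  continuous (fun v : 'rV[R]_p => ridge_obj X y lambda v^T).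
Proof.
have res i : continuous (fun v : 'rV[R]_p => (y - X *m v^T) i ord0).
  move=> v; under eq_fun do rewrite 3!mxE.
  have Xc : continuous (fun v : 'rV[R]_p => \sum_j X i j * v^T j ord0).
    apply: continuous_sumr => j {}v.
    exact: (cvgMl_tmp (@continuous_coord_trmx R p j v)).
  exact: (cvgB (cvg_cst _) (Xc v)).
move=> v.
have fit := cvgMl_tmp (a := n%:R^-1)
  (@continuous_sqnorm2 R _ n (fun v => y - X *m v^T) res v).
have pen := cvgMl_tmp (a := lambda)
  (@continuous_sqnorm2 R _ p (fun v => v^T) (@continuous_coord_trmx R p) v).
exact: (cvgD (fit _) (pen _)).
Qed.

(* The ridge term alone bounds every coordinate, whatever [X] is, through
   |a| <= 1 + a^2. Transposes appear because the library states compactness for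
   row vectors only. *)
Lemma compact_sublevel_trmx (R : realType) (n p : nat) (X : 'M[R]_(n, p))
    (y : 'cV[R]_n) (lambda q : R) : 0 < lambda ->
  compact [set v : 'rV[R]_p | sublevel X y lambda q v^T]%classic.
Proof.
move=> l0; pose M := 1 + q / lambda.
apply: (subclosed_compact _ (@rV_compact _ _ (fun=> `[- M, M]%classic) _)).
- apply: (@preimage_closed _ _ (fun v : 'rV[R]_p => ridge_obj X y lambda v^T)
    [set x | x <= q]%classic); last exact: closed_le.
  by move=> v _; exact: continuous_ridge_obj_trmx.
- by move=> i; exact: segment_compact.
- move=> v /= vq i; rewrite in_itv /= -ler_norml /M.
  (* Dropping the nonnegative fit term and the other coordinates leaves [lambda * v_i^2 <= q]. *)
  have : v ord0 i ^+ 2 <= q / lambda.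
    rewrite ler_pdivlMr // mulrC; apply: le_trans vq.
    rewrite /ridge_obj ler_wpDl ?mulr_ge0 ?invr_ge0 ?sqnorm2_ge0 //.
    have := sqr_coord_le_sqnorm2 v^T i; rewrite mxE => vi.
    by rewrite ler_pM2l.
  rewrite -real_normK ?num_real //; set a := `|_|; nra.
Qed.

Lemma ex_argmin_norm1_sublevel (R : realType) (n p : nat) (X : 'M[R]_(n, p))
    (y : 'cV[R]_n) (lambda q : R) : 0 < lambda ->
  (sublevel X y lambda q !=set0)%classic ->
  exists beta, is_argmin (sublevel X y lambda q) (@norm1 R p) beta.
Proof.
move=> l0 [b bq].
have [| |c] := @EVT_min_rV R p (fun v => norm1 v^T) _ _
  (@compact_sublevel_trmx R n p X y lambda q l0) _.
- by exists b^T; rewrite /= trmxK.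
- by apply: continuous_subspaceT; exact: continuous_norm1_trmx.
- rewrite inE /= => cq cmin; exists c^T; split => // b' b'q.
  by have := cmin b'^T; rewrite trmxK; apply; rewrite inE /= trmxK.
Qed.

(** Multiplied by [p], the chance constraint becomes [p <= count + k], where [count] is the number
    of zero entries. This compares naturals, so truncation in [p - k] is harmless. *)
Lemma chance_feasible_of_zhat (R : realType) (p k : nat) (beta : 'cV[R]_p) :
  (0 < p)%N -> (p - k <= \sum_(i < p) zhat beta i)%N -> chance_feasible k beta.
Proof.
move=> p0 pk; rewrite /chance_feasible /=.
have pR : 0 < p%:R :> R by rewrite ltr0n.
under eq_bigr do rewrite normr_le0.
rewrite -natr_sum -(ler_pM2l pR) mulrBr mulr1 mulrCA divff ?gt_eqF // mulr1.
rewrite mulrA divff ?gt_eqF // mul1r lerBlDr -natrD ler_nat.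
by rewrite addnC -leq_subLR.
Qed.

Lemma ridge_obj0 (R : realType) (n p : nat) (X : 'M[R]_(n, p)) (y : 'cV[R]_n)
  (lambda : R) : ridge_obj X y lambda 0 = sqnorm2 y / n%:R.
Proof.
rewrite /ridge_obj mulmx0 subr0 {2}/sqnorm2 big1 ?mulr0 ?addr0 1?mulrC //.
by move=> i _; rewrite mxE expr0n.
Qed.

Section Run.
Variables (R : realType) (n p k : nat) (X : 'M[R]_(n, p)) (y : 'cV[R]_n).
Variables (lambda delta : R).

Lemma bisection_run_width m s : bisection_run X y lambda k delta m s ->
  up s - lo s = sqnorm2 y / n%:R / 2 ^+ m.
Proof.
elim=> [|{}m {}s t _ IH st]; first by rewrite /= subr0 expr0 divr1.
rewrite exprS invfM mulrCA -IH.
(* Every kind of step moves exactly one endpoint to the midpoint. *)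
by case: st => * /=; rewrite /midpoint; lra.
Qed.

Lemma bisection_step_guard s t :
  bisection_step X y lambda k delta s t -> loop_guard delta s.
Proof. by case. Qed.

Lemma bisection_runS_ratio m s : (0 < n)%N -> 0 < delta ->
  bisection_run X y lambda k delta m.+1 s ->
  2 ^+ m < sqnorm2 y / (n%:R * delta).
Proof.
move=> n0 d0 H; inversion H as [|m' s' t run st]; subst.
have := bisection_step_guard st.
rewrite /loop_guard (bisection_run_width run) invfM mulrA.
by rewrite ltr_pdivlMr ?exprn_gt0 // mulrC -ltr_pdivlMr.
Qed.

(** Loop invariant: only [StepUp] changes [inc] or [up], and membership of its [beta] in the
    sublevel set at the midpoint is exactly the bound by the new [up]. *)
Lemma bisection_run_inc m s : (0 < p)%N -> bisection_run X y lambda k delta m s ->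
  chance_feasible k (inc s) /\ ridge_obj X y lambda (inc s) <= up s.
Proof.
move=> p0; elim=> [|{}m {}s t _ [IH1 IH2]].
  rewrite /= ridge_obj0; split=> //; apply: chance_feasible_of_zhat => //.
  under eq_bigr do rewrite /zhat mxE eqxx.
  by rewrite sum1_card card_ord leq_subr.
by case=> // beta _ [bq _] bk; split=> //; exact: chance_feasible_of_zhat.
Qed.

Lemma bisection_progress s : 0 < lambda -> loop_guard delta s ->
  exists t, bisection_step X y lambda k delta s t.
Proof.
move=> l0 g.
have [q0|/eqP/set0P q0] := pselect (sublevel X y lambda (midpoint s) = set0)%classic.
  by eexists; exact: StepInfeasible.
have [beta bmin] := ex_argmin_norm1_sublevel l0 q0.
have [kz|zk] := leqP (p - k)%N (\sum_(i < p) zhat beta i)%N.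
  by eexists; exact: (StepUp g bmin).
by eexists; exact: (StepLo g bmin).
Qed.

End Run.

(** The real power accommodates [z = -1], which occurs when no iteration has run; [0 < x] excludes
    the default values of [ln]. *)
Lemma le_floor_log2 (R : realType) (x : R) (z : int) : 0 < x ->
  (z <= Num.floor (log2 x)) = (2 `^ z%:~R <= x).
Proof.
move=> x0; have l2 : 0 < ln (2 : R) by rewrite ln_gt0 // ltr1n.
rewrite floor_ge_int /log2 ler_pdivlMr //.
by rewrite -[RHS]ler_ln ?posrE ?powR_gt0 // ln_powR.
Qed.

Unset Implicit Arguments.
Set Strict Implicit.

Theorem proposition2 (R : realType) (n p k : nat)
    (hn : (0 < n)%N) (hp : (0 < p)%N) (hk : (0 < k)%N)
    (hkle : (k <= minn n p)%N)
    (lambda : R) (hlambda : 0 < lambda)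
    (X : 'M[R]_(n, p)) (y : 'cV[R]_n)
    (vstar : R)
    (hvstar : is_min_value (@chance_feasible R p k) (ridge_obj X y lambda) vstar)
    (delta : R) (hdelta : 0 < delta) :
  (* (i) The stated bound floor(log2 r) + 1 is negative when r < 1/2 (and log2 r
     is undefined when y = 0): the loop body is then never executed. The last
     clause says that no execution gets stuck while the loop guard holds. *)
  ((forall m s, bisection_run X y lambda k delta m s ->
      (2^-1 <= sqnorm2 y / (n%:R * delta) ->
         m%:Z <= Num.floor (log2 (sqnorm2 y / (n%:R * delta))) + 1) /\
      (sqnorm2 y / (n%:R * delta) < 2^-1 -> m = 0%N)) /\
   (forall m s, bisection_run X y lambda k delta m s -> loop_guard delta s ->
      exists t, bisection_step X y lambda k delta s t))
  /\
  (* (ii) when the loop ends, with v^heur = up s *)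
  (forall m s, bisection_run X y lambda k delta m s -> ~ loop_guard delta s ->
     [/\ chance_feasible k (inc s),
         ridge_obj X y lambda (inc s) <= up s
       & vstar <= up s]).
Proof.
split; first split.
- move=> [|m] s run; split => // hr.
  (* For zero iterations the claim is [-1 <= floor (log2 r)], that is [2^-1 <= r]: the source of the
     threshold. *)
  + rewrite -lerBlDr sub0r le_floor_log2; last exact: lt_le_trans hr.
    by rewrite mulrN1z powR_inv1.
  (* The [+ 1] of the bound absorbs the successor, leaving [2^m <= r]. *)
  + have r := bisection_runS_ratio hn hdelta run.
    rewrite -addn1 PoszD lerD2r le_floor_log2; last exact: lt_le_trans hr.
    by rewrite -pmulrn powR_mulrn // ltW.
  (* An executed iteration would give [1 <= 2^m < 2^-1]. *)
  + have r := lt_trans (bisection_runS_ratio hn hdelta run) hr.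
    have : 1 <= 2 ^+ m :> R by rewrite exprn_ege1 // ler1n.
    by rewrite leNgt (lt_trans r) // invf_lt1 // ltr1n.
- by move=> m s _; exact: bisection_progress.
- move=> m s run _; have [feas obj] := bisection_run_inc hp run.
  split=> //; case: hvstar => b [_ bmin] <-; exact: le_trans (bmin _ feas) obj.
Qed.
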